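(* Let $A_0,\dots,A_{n-1}$ be finitely many subspaces of $\omega_1$. Then the product $\prod_{k<n}A_k$ is semi-proximal if and only if it is normal.
   Context: $\omega_1$ carries the order topology, subsets the subspace topology, and products the product topology. The proximal game on a uniform space $(X,\mathfrak U)$ (where $\mathfrak U$ is a uniformity or a base for a uniformity): in inning $0$, Player I chooses an entourage $U_0\in\mathfrak U$ and Player II chooses $x_0\in X$. In inning $n+1$, Player I chooses an entourage $U_{n+1}\in\mathfrak U$ with $U_{n+1}\subseteq U_n$ and Player II chooses $x_{n+1}\in U_n[x_n]=\{y\in X:\langle x_n,y\rangle\in U_n\}$. Player I wins if either $\bigcap_{n<\omega}U_n[x_n]=\emptyset$ or the sequence $(x_n:n<\omega)$ converges in $X$; otherwise Player II wins. A space $X$ is semi-proximal if there is a uniformity $\mathfrak U$ on $X$ compatible with its topology such that Player II has no winning strategy in the proximal game on $(X,\mathfrak U)$. *)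

(* Defs.v *)
From HB Require Import structures.
From mathcomp Require Import all_boot all_order all_algebra.
From mathcomp Require Import all_classical wochoice topology function_spaces.

Set Implicit Arguments.
Unset Strict Implicit.
Unset Printing Implicit Defensive.
Import Order.TTheory.
Local Open Scope classical_set_scope.

(* These clauses characterize the ordinal omega_1 up to a unique order
   isomorphism. *)
Definition is_omega1 d (T : orderType d) : Prop :=
  [/\ well_order (<=%O : rel T),
      ~ countable [set: T]
    & forall a : T, countable [set x : T | (x < a)%O]].

Section Proximal.
Context {X : uniformType}.

(* A (total) strategy for Player II computes x_n from Player I's moves
   U_0, ..., U_n; the earlier moves of Player II are determined by those of
   Player I and the strategy. If X is empty, then there is no strategy. *)
Definition strategyII := seq (set (X * X)) -> X.

Definition legalI (U : nat -> set (X * X)) : Prop :=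
  forall n, entourage (U n) /\ U n.+1 `<=` U n.

Definition replyII (s : strategyII) (U : nat -> set (X * X)) (n : nat) : X :=
  s (mkseq U n.+1).

Definition legalII (U : nat -> set (X * X)) (x : nat -> X) : Prop :=
  forall n, xsection (U n) (x n) (x n.+1).

Definition winsI (U : nat -> set (X * X)) (x : nat -> X) : Prop :=
  \bigcap_n xsection (U n) (x n) = set0 \/ exists l : X, x @ \oo --> l.

(* Every finite legal sequence of moves of Player I extends to an infinite one
   (by repeating the last entourage), so it suffices to test s against infinite
   sequences of moves. *)
Definition winningII (s : strategyII) : Prop :=
  forall U, legalI U -> legalII U (replyII s U) /\ ~ winsI U (replyII s U).

End Proximal.
Arguments strategyII X : clear implicits.

Definition semi_proximal (X : topologicalType) : Prop :=
  exists uX : Uniform.axioms_ X, let UX : uniformType := Uniform.Pack uX in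
    (forall x : X, @nbhs UX UX x = @nbhs X X x) /\
    ~ exists s : strategyII UX, winningII s.

(* Omega_1 exists: take the points of a well-order of the subsets of nat that
   have only countably many predecessors. *)
Definition wo_rel : rel (set nat) := sval (well_ordering_principle (set nat)).

Lemma wo_relP : wo_chain wo_rel predT.
Proof. by move=> A _; exact: (svalP (well_ordering_principle (set nat))). Qed.

Lemma wo_rel_refl : reflexive wo_rel.
Proof. by move=> x; exact: (wo_chain_reflexive wo_relP). Qed.

Lemma wo_rel_anti : antisymmetric wo_rel.
Proof. by move=> x y; exact: (wo_chain_antisymmetric wo_relP). Qed.

Lemma wo_rel_total : total wo_rel.
Proof. by move=> x y; exact: (wo_chainW wo_relP). Qed.

Lemma wo_rel_min (A : set (set nat)) : A !=set0 ->
  exists2 m, A m & forall x, A x -> wo_rel m x.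
Proof.
move=> [a Aa].
have [||m [[mA lb] _]] := @wo_relP (mem A); [by []|by exists a; apply/mem_set|].
by exists m => [|x Ax]; [exact/set_mem | apply: lb; exact/mem_set].
Qed.

Lemma wo_rel_trans : transitive wo_rel.
Proof.
move=> y x z xy yz.
have [|m Am lb] := wo_rel_min (A := [set t | [\/ t = x, t = y | t = z]]).
  by exists x; constructor 1.
have [mx my mz] : [/\ wo_rel m x, wo_rel m y & wo_rel m z].
  by split; apply: lb; [constructor 1|constructor 2|constructor 3].
case: Am => E; subst m => //.
- by rewrite -(wo_rel_anti (x := x) (y := y)) ?xy// in yz.
- have E : y = z by apply: wo_rel_anti; rewrite yz my.
  by rewrite -E.
Qed.

Definition few_preds : set (set nat) :=
  [set x | countable [set y | wo_rel y x /\ y <> x]].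

Definition omega1 : Type := set_type few_preds.
HB.instance Definition _ := Choice.on omega1.

Definition le_omega1 (x y : omega1) : bool := wo_rel (val x) (val y).

Lemma le_omega1_refl : reflexive le_omega1.
Proof. by move=> x; exact: wo_rel_refl. Qed.

Lemma le_omega1_anti : antisymmetric le_omega1.
Proof. by move=> x y /wo_rel_anti /val_inj. Qed.

Lemma le_omega1_trans : transitive le_omega1.
Proof. by move=> y x z; exact: wo_rel_trans. Qed.

Lemma le_omega1_total : total le_omega1.
Proof. by move=> x y; exact: wo_rel_total. Qed.

HB.instance Definition _ := Order.Le_isPOrder.Build (Order.Disp tt tt) omega1
  le_omega1_refl le_omega1_anti le_omega1_trans.
HB.instance Definition _ :=
  Order.POrder_isTotal.Build _ omega1 le_omega1_total.

Lemma uncountable_set_nat : ~ countable [set: set nat].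
Proof.
move=> /countable_injP[f finj].
pose D : set nat := [set n | exists2 A, f A = n & ~ A n].
have [DfD|nDfD] := pselect (D (f D)); last first.
  by apply: (nDfD); exists D.
have [A fA nA] := DfD.
have AD : A = D by apply: finj; rewrite ?inE.
by apply: nA; rewrite AD.
Qed.

Lemma omega1P : is_omega1 omega1.
Proof.
split.
- apply: antisymmetric_well_order; first exact: le_anti.
  move=> A [a aA].
  have [|_ [m mA <-] lb] := wo_rel_min (A := val @` [set x : omega1 | x \in A]).
    by exists (val a); exists a.
  by exists m; split=> // x xA; apply: lb; exists x.
- move=> cW.
  have cF : countable few_preds.
    rewrite -(_ : (val : omega1 -> _) @` setT = few_preds).
      exact: sub_countable (card_image_le _ _) cW.
    by apply/seteqP; split=> [_ [x _ <-]|x Fx];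
      [exact/set_mem/valP | exists (SigSub (mem_set Fx))].
  have [FT|/existsNP nF] := pselect (forall x, few_preds x).
    by apply: uncountable_set_nat; apply: sub_countable cF; exact: subset_card_le.
  have [b nFb lb] := wo_rel_min nF.
  apply: nFb; apply: sub_countable cF; apply: subset_card_le => y [yb neq].
  apply: contrapT => /lb bY; apply: neq; apply: wo_rel_anti; exact/andP.
- move=> a.
  have /set_mem ca : val a \in few_preds := valP a.
  apply/countable_injP; move/countable_injP : ca => [f finj].
  exists (f \o val) => x y; rewrite !inE /= => xa ya fxy.
  apply: val_inj; apply: finj => //; apply/mem_set.
  + split; first exact: (ltW xa).
    by move=> /val_inj E; rewrite E ltxx in xa.
  + split; first exact: (ltW ya).
    by move=> /val_inj E; rewrite E ltxx in ya.
Qed.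

Lemma omega1_exists :
  exists d (T : orderTopologicalType d), is_omega1 T.
Proof. by exists _, (order_topology omega1); exact: omega1P. Qed.

(* Main.v *)
(** Say that the family is good when the set [E] of all points lying in every
   stationary [A k] is stationary. Fix a club [C] missing the nonstationary [A k].

   Good implies semi-proximal: take the uniformity of all partitions into open sets.
   Given a strategy of Player II, choose [dl] in [E] and [C] closed under the
   strategy, enumerate the points below [dl] and let Player I cut every factor at
   the first [i] of them in inning [i] (and always at [C] in the nonstationary
   factors). The replies stay below [dl]; if [y] lies in all the sets [U_i[x_i]],
   they converge to the pointwise minimum of [y] and [dl].

   Good implies normal: let [H] and [K] be disjoint and closed. For [p] in the product
   and a set [S] of stationary factors, pressing down over the points of [E] placed in
   the factors of [S] gives a basic clopen neighbourhood of [p] off [S], times a tail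
   in each factor of [S], that misses [H] or [K]. On a block of the partition by [C],
   the countably many such boxes with [p] below a closed-off ordinal form a cover.

   Otherwise there are a stationary [A i] and a stationary intersection [B] of other
   factors such that the intersection of [A i] and [B] misses a club, and
   the product contains a closed copy of the plane [A i * B] (diagonal in the factors
   making up [B]). Pressing down twice, every entourage [U] has a corner
   [{(u, v) | c < u, f u < v}] that is [U]-small; Player II wins by moving to the
   corners along the diagonal, whose limit points are missing from the plane. Nor is
   the plane normal: points just to the right of the club in the first
   coordinate cannot be separated from the points with second coordinate in a
   smaller club. *)

Require Import Defs.
From HB Require Import structures.
From mathcomp Require Import all_boot all_order all_algebra.
From mathcomp Require Import all_classical topology function_spaces.

Set Implicit Arguments.
Unset Strict Implicit.
Unset Printing Implicit Defensive.
Import Order.TTheory.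

(** * Clubs and pressing down *)

Section Omega1.
Local Open Scope order_scope.
Local Open Scope classical_set_scope.
Context {d : Order.disp_t} {T : orderTopologicalType d} (hT : is_omega1 T).
Implicit Types (a b x y z dl : T) (g : T -> T) (A B : set T).

Lemma omega1_min (D : set T) : D !=set0 ->
  exists2 m, D m & forall x, D x -> m <= x.
Proof.
move=> [x Dx]; have [wo _ _] := hT.
have [|m [[mD lb] _]] := wo (mem D); first by exists x; exact/mem_set.
by exists m => [|y Dy]; [exact/set_mem|apply: lb; exact/mem_set].
Qed.

Lemma countable_le x : countable [set y | y <= x].
Proof.
have [_ _ cT] := hT; have -> : [set y | y <= x] = [set y | y < x] `|` [set x].
  apply/seteqP; split=> y /=; first by rewrite le_eqVlt => /orP[/eqP->|]; [right|left].
  by case=> [/ltW|->].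
have -> : [set y | y < x] `|` [set x] =
    \bigcup_(b in [set: bool]) (if b then [set y | y < x] else [set x]).
  apply/seteqP; split=> y; first by case=> ?; [exists true|exists false].
  by case=> -[] _ /=; [left|right].
by apply: bigcup_countable => // -[] _; [exact: cT|exact: countable1].
Qed.

Lemma countable_lt x : countable [set y | y < x].
Proof. by have [_ _] := hT. Qed.

Lemma countable_ubound (D : set T) : countable D ->
  exists b, forall x, D x -> x < b.
Proof.
move=> cD; have [_ ncT _] := hT; apply: contrapT => nb; apply: ncT.
rewrite (_ : setT = \bigcup_(x in D) [set y | y <= x]).
  by apply: bigcup_countable => // x _; exact: countable_le.
apply/seteqP; split=> // y _; apply: contrapT => ny; apply: nb; exists y => x Dx.
by rewrite ltNge; apply/negP => yx; apply: ny; exists x.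
Qed.

Lemma range_ubound (I : countType) (f : I -> T) : exists b, forall i, f i < b.
Proof.
have [|b bP] := @countable_ubound (range f).
  by apply: sub_countable (card_image_le _ _) _.
by exists b => i; apply: bP; exists i.
Qed.

(* Every club contains a set of this form, and every set of this form is a club; so
   [stationary] below is the usual notion. *)
Definition club a g : set T := [set dl | a < dl /\ forall x, x < dl -> g x < dl].

Definition stationary A := forall a g, exists2 dl, A dl & club a g dl.

(* [code p] lists the finitely many ordinals on which [p] depends. *)
Lemma countable_code (P : Type) (I : countType) (code : P -> seq T * I) x :
  injective code -> countable [set p | {in (code p).1, forall z, z <= x}].
Proof.
move=> codeI; have /countable_injP[f fI] := countable_le x.
apply/countable_injP.
exists (fun p => choice.pickle (map f (code p).1, (code p).2)) => p q.
rewrite !inE /= => px qx /(pcan_inj choice.pickleK)[E1 E2].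
apply: codeI; move: E1 E2 px qx; case: (code p) (code q) => [s i] [t j] /= + -> {i}.
move=> E sx tx; congr (_, _); elim: s t E sx tx => [|u s IH] [|v t] //=.
move=> [uv st] sx tx; congr (_ :: _).
  by apply: fI => //; rewrite inE /=; [apply: sx|apply: tx]; rewrite mem_head.
by apply: IH => // z zs; [apply: sx|apply: tx]; rewrite inE zs orbT.
Qed.

Lemma seq_ubound (F : seq T) y dl : y < dl -> {in F, forall z, z < dl} ->
  exists x, [/\ y <= x, x < dl & {in F, forall z, z <= x}].
Proof.
move=> ydl; elim: F => [|u F IH] Fdl; first by exists y.
have [z zs|x [yx xdl xP]] := IH; first by apply: Fdl; rewrite inE zs orbT.
exists (Order.max u x); split; first by rewrite le_max yx orbT.
  by rewrite gt_max xdl Fdl// mem_head.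
move=> z; rewrite inE le_max => /orP[/eqP->|/xP->]; first by rewrite lexx.
by rewrite orbT.
Qed.

(** Only countably many [p] have a code bounded by a given [x], so their values have a common bound
    [g x]; a finite code below [dl] is bounded by some [x < dl]. *)
Lemma closing_fun (P : Type) (I : countType) (code : P -> seq T * I) (h : P -> T) :
  injective code -> exists g, forall a dl, club a g dl ->
  forall p, {in (code p).1, forall z, z < dl} -> h p < dl.
Proof.
move=> codeI.
have /choice [g gP] x : exists b, forall p, {in (code p).1, forall z, z <= x} -> h p < b.
  have [|b bP] := @countable_ubound (h @` [set p | {in (code p).1, forall z, z <= x}]).
    by apply: sub_countable (card_image_le _ _) _; exact: countable_code.
  by exists b => p px; apply: bP; exists p.
exists g => a dl [adl cl] p pdl.
have [x [_ xdl xP]] := seq_ubound adl pdl.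
by apply: lt_trans (cl _ xdl); apply: gP.
Qed.

(** Fodor's lemma for values coded by finite sets of smaller ordinals and a countable label. If each
    fibre were bounded by some [h p], a point of [A] closed under [h] would exceed the bound of its
    own fibre. *)
Lemma pressing_down (P : Type) (I : countType) (code : P -> seq T * I)
    (f : T -> P) A a : injective code -> stationary A ->
  (forall dl, A dl -> a < dl -> {in (code (f dl)).1, forall z, z < dl}) ->
  exists p, forall b, exists dl, [/\ A dl, b < dl & f dl = p].
Proof.
move=> codeI statA reg; apply: contrapT => /forallNP nf.
have /choice[h hP] p : exists b, forall dl, A dl -> f dl = p -> dl <= b.
  have /existsNP[b /forallNP bP] := nf p; exists b => dl Adl fdl.
  by rewrite leNgt; apply/negP => bdl; apply: (bP dl).
have [g gP] := closing_fun h codeI.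
have [dl Adl cdl] := statA a g.
have := gP _ _ cdl _ (reg _ Adl cdl.1).
by rewrite ltNge hP.
Qed.

Lemma stationaryT : stationary setT.
Proof.
move=> a g.
have /choice[g' g'P] x : exists b, x < b /\ forall y, y <= x -> g y < b.
  have [|b bP] := @countable_ubound ([set y | y <= x] `|` g @` [set y | y <= x]).
    rewrite -bigcup2E; apply: bigcup_countable => // -[|[|i]] _ /=.
    - exact: countable_le.
    - by apply: sub_countable (card_image_le _ _) _; exact: countable_le.
    - exact: countable0.
  exists b; split=> [|y yx]; apply: bP; first by left; exact: lexx.
  by right; exists y.
(* The least point [dl] above this increasing sequence is closed under [g], since every point below
   [dl] is at most some [al i]. *)
pose al i := iter i g' (g' a).
have [b bP] := range_ubound al.
have [|dl dlP dlm] := @omega1_min [set x | forall i, al i < x]; first by exists b.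
exists dl => //; split; first exact: lt_trans (g'P a).1 (dlP 0).
move=> x xdl; have [[i xi]|/forallNP nx] := pselect (exists i, x <= al i).
  by apply: lt_trans (dlP i.+1); exact: (g'P (al i)).2.
have /dlm : [set y | forall i, al i < y] x by move=> i; rewrite ltNge; apply/negP/nx.
by rewrite leNgt xdl.
Qed.

Lemma stationary_unbounded A b : stationary A -> exists2 x, A x & b < x.
Proof. by move=> /(_ b id)[x Ax [bx _]]; exists x. Qed.

(** Bounding the countably many parameters pointwise gives a single club inside all the given
    ones. *)
Lemma clubI (I : countType) (a : I -> T) (g : I -> T -> T) :
  exists a' g', forall i, club a' g' `<=` club (a i) (g i).
Proof.
have [a' a'P] := range_ubound a.
have /choice[g' g'P] x := range_ubound (g ^~ x).
exists a', g' => i dl [adl cl]; split; first exact: lt_trans adl.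
by move=> x /cl; exact: lt_trans.
Qed.

Lemma stationary_club A a g : stationary A -> stationary (A `&` club a g).
Proof.
move=> sA b h.
have [a' [g' sub]] := clubI (fun c : bool => if c then a else b)
                            (fun c : bool => if c then g else h).
have [dl Adl cdl] := sA a' g'.
by exists dl; [split=> //; exact: (sub true)|exact: (sub false)].
Qed.

Lemma clubU (I : countType) (A : I -> set T) : (forall i, ~ stationary (A i)) ->
  exists a g, forall i x, club a g x -> ~ A i x.
Proof.
move=> nst.
have /choice[ag agP] i : exists p : T * (T -> T), forall x, A i x -> ~ club p.1 p.2 x.
  have /existsNP[a /existsNP[g nag]] := nst i; exists (a, g) => x Aix cx.
  by apply: nag; exists x.
have [a [g agE]] := clubI (fun i => (ag i).1) (fun i => (ag i).2).
by exists a, g => i x /(agE i) cx /agP; exact.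
Qed.

(** * Neighbourhoods in the order topology *)

Lemma open_le x : open [set y | y <= x].
Proof.
have [b bP] := countable_ubound (countable1 x).
(* [s] is the successor of [x], so the closed ray is the open ray below [s]. *)
have [|s xs sm] := @omega1_min [set y | x < y]; first by exists b; exact: bP.
rewrite (_ : [set y | _] = `]-oo, s[%classic); first exact: lray_open.
apply/seteqP; split=> y /=; rewrite in_itv /=; last first.
  by move=> ys; rewrite leNgt; apply/negP => /sm; rewrite leNgt ys.
by move=> yx; exact: le_lt_trans xs.
Qed.

Lemma open_gt x : open [set y | x < y].
Proof.
have := rray_open x; rewrite (_ : `]x, +oo[%classic = [set y | x < y])//.
by apply/seteqP; split=> y /=; rewrite in_itv /= andbT.
Qed.

(** [F] holds the left endpoint, if there is one; lists can later be concatenated over the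
    factors. *)
Lemma nbhs_ltle x (W : set T) : nbhs x W ->
  exists F : seq T, {in F, forall z, z < x} /\
    forall y, {in F, forall z, z < y} -> y <= x -> W y.
Proof.
rewrite itv_nbhsE => -[[l r] [oi xi] iW].
have ry y : y <= x -> (BRight y <= r)%O.
  move=> yx; have [_ xr] := andP xi.
  by apply: le_trans xr; rewrite bnd_simp.
case: l oi xi iW => [[] l|[]] //= oi xi iW; last first.
- exists [::]; split=> // y _ yx; apply: iW; rewrite /= inE.
  by apply/andP; split=> //; exact: ry.
- exists [:: l]; split=> [z|y Fy yx].
    by rewrite inE => /eqP ->; case/andP: xi.
  apply: iW; apply/andP; split; last exact: ry.
  by rewrite bnd_simp Fy// mem_head.
Qed.

End Omega1.

(** * Neighbourhoods in a product of subspaces *)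

Section Product.
Local Open Scope order_scope.
Local Open Scope classical_set_scope.
Context {d : Order.disp_t} {T : orderTopologicalType d} (hT : is_omega1 T).
Context {n : nat} {A : 'I_n -> set T}.
Local Notation X := (prod_topology (fun k : 'I_n => set_type (A k))).
Implicit Types (p q x y : X) (F : seq T) (k : 'I_n).

Definition co x k : T := val (x k).

Lemma coP x k : A k (co x k).
Proof. exact: set_valP. Qed.

Lemma co_inj x y : co x =1 co y -> x = y.
Proof.
by move=> xy; apply: functional_extensionality_dep => k; apply: val_inj; exact: xy.
Qed.

(** Where [u k] is outside [A k] the coordinate falls back on [p k], so points can be formed before
    membership is proved. *)
Definition repl p (u : 'I_n -> T) : X := fun k => insubd (p k) (u k).

Lemma co_repl p u k : A k (u k) -> co (repl p u) k = u k.
Proof. by move=> Au; rewrite /co /repl insubdK//; exact/mem_set. Qed.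

Lemma prod_cvg (G : set_system X) (FG : Filter G) x :
  (forall k (W : set T), nbhs (co x k) W -> G [set y | W (co y k)]) -> G --> x.
Proof.
move=> Gx; apply/cvg_sup => k W [B [[V oV <-] Vx] VW].
case: oV Vx VW => V' oV' <- V'x VW.
by apply: filterS VW _; apply: (Gx k V'); exact: open_nbhs_nbhs.
Qed.

Lemma co_continuous k : continuous (co^~ k : X -> T).
Proof.
move=> x W xW.
have /cvg_sup xx : nbhs x --> x by apply: cvg_id.
have [V [oV xV] VW] : exists2 V, open_nbhs (co x k) V & V `<=` W.
  by move: xW; rewrite nbhsE.
apply: (xx k).
exists (co^~ k @^-1` V); split=> //; last by move=> y /VW.
by exists (set_val @^-1` V) => //; exists V.
Qed.

(** The partition into finitely many clopen boxes obtained by cutting every factor just after each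
    point of [F]. *)
Definition same F x y := forall k, {in F, forall z, (co x k <= z) = (co y k <= z)}.

Lemma near_same F x : \forall y \near x, same F x y.
Proof.
apply: (@filter_forall X 'I_n
  (fun k y => {in F, forall z, (co x k <= z) = (co y k <= z)}) (nbhs x) _) => k.
elim: F => [|z F IH]; first by apply: nearW => y z.
have near_z : \forall y \near x, (co x k <= z) = (co y k <= z).
  have [xz|zx] := leP (co x k) z.
    apply: (@filterS X (nbhs x) _ (co^~ k @^-1` [set u | u <= z])) => [y /= ->//|].
    exact: (co_continuous (open_nbhs_nbhs (conj (open_le hT z) xz))).
  apply: (@filterS X (nbhs x) _ (co^~ k @^-1` [set u | z < u])) => [y /=|].
    by rewrite ltNge => /negbTE.
  exact: (co_continuous (open_nbhs_nbhs (conj (open_gt z) zx))).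
apply: filterS2 near_z IH => y yz IH w; rewrite inE => /orP[/eqP->//|]; exact: IH.
Qed.

(** The cuts lie strictly below [dl] even when coordinates of [q] equal [dl]; this is the regressive
    choice to which pressing down applies. *)
Lemma nbhs_same q (W : set X) dl : nbhs q W -> (forall k, co q k <= dl) ->
  exists F, {in F, forall z, z < dl} /\
    forall x, same F q x -> (forall k, co x k <= dl) -> W x.
Proof.
move=> qW qdl.
pose G : set_system X := [set V | exists F, {in F, forall z, z < dl} /\
    forall x, same F q x -> (forall k, co x k <= dl) -> V x].
have FG : Filter G.
  split=> [|V1 V2 [F1 [F1dl F1V]] [F2 [F2dl F2V]]|V1 V2 V12 [F [Fdl FV]]].
  - by exists [::].
  - exists (F1 ++ F2); split=> [z|x sx xdl].
      by rewrite mem_cat => /orP[/F1dl|/F2dl].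
    by split; [apply: F1V|apply: F2V] => // k z zF; apply: sx; rewrite mem_cat zF ?orbT.
  - by exists F; split=> // x sx xdl; apply: V12; exact: FV.
suff : G --> q by apply.
apply: prod_cvg => k V /nbhs_ltle[F [Fq FV]].
(* A coordinate of [q] below [dl] becomes a cut itself; otherwise the bound on [x] replaces that
   cut. *)
have [qkdl|dlqk] := ltP (co q k) dl.
- exists (co q k :: F); split=> [z|x sx xdl].
    by rewrite inE => /orP[/eqP->//|/Fq /lt_trans]; apply.
  apply: FV; last by rewrite -sx ?mem_head.
  by move=> z zF; rewrite ltNge -sx ?inE ?zF ?orbT// -ltNge Fq.
- exists F; split=> [z /Fq /lt_le_trans|x sx xdl]; first by apply.
  apply: FV; last exact: le_trans dlqk.
  by move=> z zF; rewrite ltNge -sx// -ltNge Fq.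
Qed.

End Product.

(** * The partition uniformity *)

Section OpenEquivalence.
Local Open Scope classical_set_scope.
Local Open Scope relation_scope.
Context {X : topologicalType}.

Definition open_equiv (R : X -> X -> Prop) : Prop :=
  [/\ forall x, \forall y \near x, R x y,
      forall x y, R x y -> R y x
    & forall x y z, R x y -> R y z -> R x z].

Definition open_equiv_ent : set_system (X * X) :=
  [set V | exists2 R, open_equiv R & forall x y, R x y -> V (x, y)].

Lemma open_equiv_refl R x : open_equiv R -> R x x.
Proof. by move=> [op _ _]; exact: nbhs_singleton (op x). Qed.

Lemma open_equiv_ent_filter : Filter open_equiv_ent.
Proof.
split=> [|V W [R [oR sR tR] RV] [S [oS sS tS] SW]|V W VW [R eR RV]].
- by exists (fun _ _ => True) => //; split=> // x; exact: nearW.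
- exists (fun x y => R x y /\ S x y); last by move=> x y [/RV ? /SW].
  split=> [x|x y [/sR ? /sS]|x y z [Rxy Sxy] [/(tR _ _ _ Rxy) ? /(tS _ _ _ Sxy)]] //.
  exact: (filterI (oR x) (oS x)).
- by exists R => // x y /RV /VW.
Qed.

Lemma open_equiv_ent_diagonal V : open_equiv_ent V -> diagonal `<=` V.
Proof.
move=> [R eR RV] [x y] /= xy; apply: RV; rewrite -[y]xy.
exact: open_equiv_refl.
Qed.

Lemma open_equiv_ent_inv V : open_equiv_ent V -> open_equiv_ent V^-1.
Proof. by move=> [R [oR sR tR] RV]; exists R => // x y /sR /RV. Qed.

Lemma open_equiv_ent_split V : open_equiv_ent V ->
  exists2 W, open_equiv_ent W & W \; W `<=` V.
Proof.
move=> [R [oR sR tR] RV]; exists [set xy | R xy.1 xy.2]; first by exists R.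
by move=> [x z] /= [y Rxy Ryz]; apply: RV; exact: tR Ryz.
Qed.

End OpenEquivalence.

(* A copy of [X] carrying the uniformity of all partitions into open sets. *)
Definition partition_space (X : topologicalType) : Type := X.

HB.instance Definition _ (X : topologicalType) := Choice.on (partition_space X).
HB.instance Definition _ (X : topologicalType) :=
  @isUniform.Build (partition_space X) (@open_equiv_ent X)
    (@open_equiv_ent_filter X) (@open_equiv_ent_diagonal X)
    (@open_equiv_ent_inv X) (@open_equiv_ent_split X).

Section PartitionSpace.
Local Open Scope classical_set_scope.
Context {X : topologicalType}.

Lemma nbhs_partition_space :
  (forall (x : X) W, nbhs x W -> exists2 R, open_equiv R & R x `<=` W) ->
  forall x : X, @nbhs _ (partition_space X) x = nbhs x.
Proof.
move=> zd x; rewrite -(@filter_from_entourageE (partition_space X)).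
apply/seteqP; split=> W.
- move=> [V [R [oR _ _] RV] VW].
  by apply: filterS (oR x) => y Rxy; apply: VW; rewrite /xsection /= inE; exact: RV.
- move=> /zd[R eR RW]; exists [set xy | R xy.1 xy.2]; first by exists R.
  by move=> y; rewrite /xsection /= inE; exact: RW.
Qed.

End PartitionSpace.

(** * Separation by clopen sets *)

Section Separation.
Local Open Scope classical_set_scope.
Context {X : topologicalType}.

(** With [Y := Prop] this encodes clopen sets. *)
Definition locally_constant (Y : Type) (f : X -> Y) : Prop :=
  forall x, \forall y \near x, f y = f x.

Lemma locally_constant_closed (G : set X) : locally_constant G -> closed G.
Proof.
move=> Gc x xG; have [y [Gy Gyx]] := xG _ (Gc x).
by rewrite -Gyx.
Qed.

(* [rep] picks the block containing a point; inside each block, membership in the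
   first member of the cover that contains the point decides the side. *)
Lemma countable_cover_separation (H K : set X) (rep : X -> X)
    (O : X -> nat -> set X) :
  locally_constant rep -> (forall r i, locally_constant (O r i)) ->
  (forall x, exists i, O (rep x) i x) ->
  (forall r i, O r i `&` H = set0 \/ O r i `&` K = set0) ->
  exists G : set X, [/\ locally_constant G, H `<=` G & G `&` K = set0].
Proof.
move=> crep cO cov OHK.
have first_in x : exists i, O (rep x) i x /\ forall j, (j < i)%N -> ~ O (rep x) j x.
  have [i Oi] := cov x; elim/ltn_ind: i Oi => i IH Oi.
  have [[j ji Oj]|nO] := pselect (exists2 j, (j < i)%N & O (rep x) j x).
    exact: IH ji Oj.
  by exists i; split=> // j ji Oj; apply: nO; exists j.
have first_uniq x i j : O (rep x) i x -> (forall k, (k < i)%N -> ~ O (rep x) k x) ->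
    O (rep x) j x -> (forall k, (k < j)%N -> ~ O (rep x) k x) -> i = j.
  by move=> Oi mi Oj mj; case: (ltngtP i j) => // [/mj|/mi].
pose G : set X := [set x | exists i, [/\ O (rep x) i x,
  forall j, (j < i)%N -> ~ O (rep x) j x & O (rep x) i `&` K = set0]].
exists G; split.
- move=> x; have [i [Oi mi]] := first_in x.
  (* Only the finitely many members up to the first one containing [x] matter, so all of them are
     constant near [x]. *)
  have near_i : \forall y \near x, forall j : 'I_i.+1, O (rep x) j y = O (rep x) j x.
    by apply: filter_forall => j; exact: cO.
  apply: filterS2 (crep x) near_i => y ry Oy; apply/propext.
  have Oiy : O (rep x) i y by rewrite (Oy ord_max).
  have miy j : (j < i)%N -> ~ O (rep x) j y.
    by move=> ji; rewrite (Oy (Ordinal (ltnW (ji : (j.+1 < i.+1)%N)))); exact: mi.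
  rewrite /G /= ry; split=> -[j [Oj mj OK]]; exists i.
    have ij : i = j by have := first_uniq y i j; rewrite ry; apply.
    by split=> //; rewrite ij.
  have ij : i = j by exact: (first_uniq x).
  by split=> //; rewrite ij.
- move=> x Hx; have [i [Oi mi]] := first_in x; exists i; split=> //.
  by case: (OHK (rep x) i) => // /seteqP[/(_ x)]; case.
- by apply/seteqP; split=> // x [[i [Oi _ /seteqP[/(_ x) + _]]] Kx]; apply.
Qed.

Lemma normal_spaceP :
  (forall H K : set X, closed H -> closed K -> H `&` K = set0 ->
    exists G : set X, [/\ locally_constant G, H `<=` G & G `&` K = set0]) ->
  normal_space X.
Proof.
move=> sep H cH W HW.
have [||G [Gc HG GK]] := sep H (~` W°) cH.
- by apply: open_closedC; exact: open_interior.
- by apply/seteqP; split=> // x [/HW ? ]; apply.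
exists G => [x /HG Gx|]; first by apply: filterS (Gc x) => y ->.
apply: subset_trans (@interior_subset _ W).
rewrite -(closure_id _).1; last exact: locally_constant_closed.
by move=> x Gx; apply: contrapT => Wx; have : (G `&` ~` W°) x by []; rewrite GK.
Qed.

Lemma normal_separation (H K : set X) : normal_space X ->
  closed H -> closed K -> H `&` K = set0 ->
  exists G : set X, [/\ forall x, H x -> nbhs x G & closure G `&` K = set0].
Proof.
move=> nX cH cK HK; have [|G HG GK] := nX H cH (~` K).
  move=> x Hx; apply: open_nbhs_nbhs; split; first exact: closed_openC.
  by move=> Kx; have : (H `&` K) x by []; rewrite HK.
by exists G; split=> //; apply/seteqP; split=> // x [/GK].
Qed.

End Separation.

Lemma countable_enum (P : Type) (D : set P) : countable D -> (D !=set0)%classic ->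
  exists z : nat -> P, (forall i, D (z i)) /\ forall p, D p -> exists i, z i = p.
Proof.
move=> /countable_injP[f fI] [p0 Dp0].
have /choice[z zP] i : exists p, D p /\ forall q, D q -> f q = i -> q = p.
  have [[p [Dp fp]]|nex] := pselect (exists p, D p /\ f p = i).
    by exists p; split=> // q Dq fq; apply: fI; rewrite ?inE// fp.
  by exists p0; split=> // q Dq fq; exfalso; apply: nex; exists q.
exists z; split=> [i|p Dp]; first exact: (zP i).1.
by exists (f p); exact/esym/(zP (f p)).2.
Qed.

(** * Semi-proximal products *)

Section Blocks.
Local Open Scope order_scope.
Local Open Scope classical_set_scope.
Context {d : Order.disp_t} {T : orderTopologicalType d} (hT : is_omega1 T).

Definition unseparated (C : set T) (u v : T) := forall w, C w -> (u <= w) = (v <= w).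

(** A point [u] outside the club is at most [a], or at most [g y] for some [y < u]; either way no
    club point lies just below [u]. *)
Lemma near_unseparated a g u : ~ club a g u ->
  \forall v \near u, unseparated (club a g) u v.
Proof.
move=> nCu.
have near_le : \forall v \near u, v <= u.
  exact: (open_nbhs_nbhs (conj (open_le hT u) (lexx u))).
have [ua|au] := leP u a.
  apply: filterS near_le => v vu w [aw _].
  by rewrite (ltW (le_lt_trans ua aw)) (ltW (le_lt_trans (le_trans vu ua) aw)).
have [y yu gy] : exists2 y, y < u & u <= g y.
  apply: contrapT => ny; apply: nCu; split=> // y yu.
  by rewrite ltNge; apply/negP => gy; apply: ny; exists y.
have near_gt : \forall v \near u, y < v.
  exact: (open_nbhs_nbhs (conj (open_gt y) yu)).
apply: filterS2 near_le near_gt => v vu yv w [_ cw].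
apply/idP/idP => [uw|vw]; first exact: le_trans uw.
by have := cw y (lt_le_trans yv vw); move=> /(le_lt_trans gy)/ltW.
Qed.

Context {n : nat} {A : 'I_n -> set T}.
Local Notation X := (prod_topology (fun k : 'I_n => set_type (A k))).

Lemma nonstationary_club :
  exists a g, forall k, ~ stationary (A k) -> forall x, club a g x -> ~ A k x.
Proof.
have [k|a [g agP]] := @clubU _ _ hT 'I_n
    (* Stationary factors are replaced by the empty set, so that [clubU] applies to all indices. *)
    (fun k => if `[< stationary (A k) >] then set0 else A k).
  have [b _] := countable_ubound hT (countable0 T).
  by case: asboolP => // _ /(_ b id)[].
by exists a, g => k nk x /(agP k); rewrite asboolF.
Qed.

Lemma same_open_equiv (F : seq T) : open_equiv (@same _ _ _ A F).
Proof.
split=> [x|x y xy k z zF|x y z xy yz k w wF].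
- exact: near_same.
- by rewrite xy.
- by rewrite xy// yz.
Qed.

Lemma same_base (x : X) W : nbhs x W -> exists2 R, open_equiv R & R x `<=` W.
Proof.
move=> xW; have [dl xdl] := range_ubound hT (co x).
have [F [_ FW]] := nbhs_same xW (fun k => ltW (xdl k)).
(* The extra cut at [dl] keeps all related points at or below [dl]. *)
exists (same (dl :: F)); first exact: same_open_equiv.
move=> y xy; apply: FW => [k z zF|k]; first by apply: xy; rewrite inE zF orbT.
by rewrite -(xy k) ?mem_head// ltW.
Qed.

(** All points of a club serve as cuts here; the classes are open once the club misses the factors
    being cut. *)
Definition same_block (C : set T) (x y : X) :=
  forall k, ~ stationary (A k) -> unseparated C (co x k) (co y k).

Lemma same_block_open_equiv a g :
  (forall k, ~ stationary (A k) -> forall u, club a g u -> ~ A k u) ->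
  open_equiv (same_block (club a g)).
Proof.
move=> CA; split=> [x|x y xy k nk w Cw|x y z xy yz k nk w Cw].
- apply: (@filter_forall X 'I_n
    (fun k y => ~ stationary (A k) -> unseparated (club a g) (co x k) (co y k))
    (nbhs x) _) => k.
  have [sk|nk] := pselect (stationary (A k)); first by apply: nearW.
  have nC : ~ club a g (co x k) by move=> /(CA k nk); apply; exact: coP.
  apply: (@filterS X (nbhs x) _ (co^~ k @^-1` unseparated (club a g) (co x k))) => //.
  exact: (co_continuous (near_unseparated nC)).
- by rewrite xy.
- by rewrite xy// yz.
Qed.

Context (statA : stationary [set x | forall k, stationary (A k) -> A k x]).

Lemma stationary_club_closing (I : countType) (P : Type) (code : P -> seq T * I)
    (h : P -> T) a g : injective code ->
  exists dl, [/\ forall k, stationary (A k) -> A k dl, club a g dl &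
    forall p, {in (code p).1, forall z, z < dl} -> h p < dl].
Proof.
move=> codeI; have [g' g'P] := closing_fun hT h codeI.
have [a1 [g1 sub]] := clubI hT (fun b : bool => a) (fun b : bool => if b then g else g').
have [dl Adl cdl] := statA a1 g1.
by exists dl; split=> //; [exact: (sub true)|apply: (g'P a); exact: (sub false)].
Qed.

Lemma semi_proximal_prod : semi_proximal X.
Proof.
exists (Uniform.class (partition_space X : uniformType)).
have nbhsX := nbhs_partition_space same_base.
split=> // -[s sP].
have [a [g CA]] := nonstationary_club.
pose U (F : seq T) : set (X * X) :=
  [set xy | same F xy.1 xy.2 /\ same_block (club a g) xy.1 xy.2].
have UentF F : open_equiv_ent (U F).
  have [oS sS tS] := same_open_equiv F; have [oB sB tB] := same_block_open_equiv CA.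
  exists (fun x y => same F x y /\ same_block (club a g) x y) => //.
  split=> [x|x y [/sS ? /sB]|x y z [xy bxy] [/(tS _ _ _ xy) ? /(tB _ _ _ bxy)]] //.
  exact: (filterI (oS x) (oB x)).
(* The list [F] of cuts determines the whole run up to this reply, so closing under [h] closes [dl]
   under the strategy. *)
have /choice[h hP] F : exists b, forall k,
    co (s (mkseq (fun i => U (take i F)) (size F).+1)) k < b.
  exact: range_ubound.
have [|dl [Adl [adl cdl] hdl]] :=
  @stationary_club_closing unit _ (fun F => (F, tt)) h a g; first by move=> F G [].
have [|z [zdl zP]] := @countable_enum _ [set w | w < dl] (countable_lt hT dl).
  by exists a.
pose V i := U (mkseq z i).
have mem_z (F : seq T) : {in F, forall w, w < dl} ->
    \forall i \near \oo, {in F, forall w, w \in mkseq z i}.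
  elim: F => [|w F IH] Fdl; first by apply: nearW => i w.
  have [j zj] := zP w (Fdl w (mem_head _ _)).
  have near_F := IH (fun v vF => Fdl v (@mem_behead _ (w :: F) v vF)).
  apply: filterS2 near_F (nbhs_infty_gt j) => i iF ji v.
  rewrite inE => /orP[/eqP->|]; last exact: iF.
  by rewrite -zj; apply/mapP; exists j => //; rewrite mem_iota.
have Vlegal : @legalI (partition_space X) V.
  move=> i; split; first exact: UentF.
  move=> [x y] [/= sxy bxy]; split=> //= k w wi; apply: sxy.
  by rewrite mkseqS mem_rcons inE wi orbT.
have xdl i k : co (@replyII (partition_space X) s V i) k < dl.
  have zi : {in mkseq z i, forall w, w < dl} by move=> w /mapP[j _ ->]; exact: zdl.
  apply: lt_trans (hdl _ zi); rewrite /replyII.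
  have -> : mkseq V i.+1 = mkseq (fun j => U (take j (mkseq z i))) (size (mkseq z i)).+1.
    rewrite size_mkseq; apply/eq_in_map => j; rewrite mem_iota add0n ltnS => /= ji.
    by rewrite /V /mkseq -map_take take_iota (minn_idPl ji).
  exact: hP.
have [_] := sP V Vlegal; apply.
have [V0|/eqP/set0P[y yV]] := pselect
    (\bigcap_n xsection (V n) (@replyII (partition_space X) s V n) = set0).
  by left.
have xy i : V i (@replyII (partition_space X) s V i, y).
  by have := yV i Logic.I; rewrite /xsection /= inE.
(* Replies lie below [dl] and agree with [y] on more and more cuts below [dl], which forces this
   limit. *)
pose l : X := repl y (fun k => Order.min (co y k) dl).
have lE k : co l k = Order.min (co y k) dl.
  apply: co_repl; have [sk|nk] := pselect (stationary (A k)).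
    by rewrite minEle; case: ifP => _; [exact: coP|exact: Adl].
  (* Being in the club, [dl] does not separate [y] from the replies in a nonstationary factor, so
     [co y k <= dl] there. *)
  rewrite min_l; first exact: coP.
  by rewrite -((xy 0).2 k nk dl (conj adl cdl)); exact/ltW/xdl.
right; exists l; rewrite nbhsX => W /nbhs_same lW.
have [k|F [Fdl FW]] := lW dl; first by rewrite lE ge_min lexx orbT.
apply: filterS (mem_z F Fdl) => i iF; apply: FW => [k w wF|k]; last exact/ltW/xdl.
rewrite lE ge_min [dl <= w]leNgt Fdl// orbF.
by rewrite -((xy i).1 k w (iF w wF)).
Qed.

End Blocks.

(** * Normal products *)

Section Normal.
Local Open Scope order_scope.
Local Open Scope classical_set_scope.
Context {d : Order.disp_t} {T : orderTopologicalType d} (hT : is_omega1 T).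
Context {n : nat} {A : 'I_n -> set T}.
Local Notation X := (prod_topology (fun k : 'I_n => set_type (A k))).
Context (statA : stationary [set x | forall k, stationary (A k) -> A k x]).

Definition box (F : seq T) (pS : X * {set 'I_n}) : set X :=
  [set x | forall k, {in F, forall z, if k \in pS.2 then z < co x k
                                     else (co pS.1 k <= z) == (co x k <= z)}].

Lemma locally_constant_box F pS : locally_constant (box F pS).
Proof.
move=> x; apply: filterS (near_same hT F x) => y xy; apply/propext.
by split=> bx k z zF; have := bx k z zF; rewrite !ltNge (xy k z zF).
Qed.

Lemma box_disjoint (H K : set X) (pS : X * {set 'I_n}) :
  closed H -> closed K -> H `&` K = set0 ->
  (forall k, k \in pS.2 -> stationary (A k)) ->
  exists F, box F pS `&` H = set0 \/ box F pS `&` K = set0.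
Proof.
case: pS => p S /= cH cK HK statS.
have [b pb] := range_ubound hT (co p).
pose q dl : X := repl p (fun k => if k \in S then dl else co p k).
pose E := [set x | forall k, stationary (A k) -> A k x].
have qE dl k : E dl -> co (q dl) k = if k \in S then dl else co p k.
  move=> Edl; apply: (co_repl p); case: ifPn => [kS|_]; last exact: coP.
  exact/Edl/statS.
(* The boolean records which of [H] and [K] the neighbourhood of [q dl] misses; it is pressed down
   along with the cuts. *)
have /choice[f fP] dl : exists Fc : seq T * bool, E dl -> b < dl ->
    {in Fc.1, forall z, z < dl} /\ forall x, same Fc.1 (q dl) x ->
    (forall k, co x k <= dl) -> ~ (if Fc.2 then H else K) x.
  have [[Edl bdl]|ndl] := pselect (E dl /\ b < dl); last first.
    by exists ([::], true) => Edl bdl; case: ndl.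
  have qdl k : co (q dl) k <= dl.
    by rewrite qE//; case: ifP => // _; exact/ltW/(lt_trans (pb k)).
  have [c nc] : exists c : bool, ~ (if c then H else K) (q dl).
    have [Hq|nHq] := pselect (H (q dl)); last by exists true.
    by exists false => Kq; have : (H `&` K) (q dl) by []; rewrite HK.
  have [|F [Fdl FP]] := nbhs_same (W := ~` (if c then H else K)) _ qdl.
    by apply: open_nbhs_nbhs; split=> //; apply: closed_openC; case: (c).
  by exists (F, c).
have [|[F c] Fc] := @pressing_down _ _ hT _ _ id f E b (@inj_id _) statA.
  by move=> dl Edl bdl; case: (fP dl Edl bdl).
have boxc x : box F (p, S) x -> ~ (if c then H else K) x.
  move=> xF; have [b' xb'] := range_ubound hT (co x).
  (* A [dl] above all coordinates of [x] puts [x] into the chosen neighbourhood of [q dl]. *)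
  have [dl [Edl]] := Fc (Order.max b b').
  rewrite gt_max => /andP[bdl b'dl] fdl.
  have [Fdl FP] := fP dl Edl bdl; rewrite fdl /= in Fdl FP.
  apply: FP => [k z zF|k]; last exact/ltW/(lt_trans (xb' k)).
  have := xF k z zF; rewrite /= qE//; case: ifP => _ zx; last exact/eqP.
  by rewrite leNgt Fdl// leNgt zx.
case: c {Fc} boxc => boxc; exists F; [left|right];
  by apply/seteqP; split=> // x [/boxc].
Qed.

Lemma normal_prod : normal_space X.
Proof.
apply: normal_spaceP => H K cH cK HK.
have [[x0 _]|nX] := pselect (exists x : X, True); last first.
  by exists set0; split=> [x|x|]; [case: nX; exists x..|rewrite set0I].
have [a [g CA]] := nonstationary_club hT (A := A).
have [oB sB tB] := same_block_open_equiv hT CA.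
pose C := club a g.
pose valid (pS : X * {set 'I_n}) := forall k, k \in pS.2 -> stationary (A k).
have /choice[F FP] pS : exists F, valid pS ->
    box F pS `&` H = set0 \/ box F pS `&` K = set0.
  have [/(box_disjoint cH cK HK)[F FP]|nv] := pselect (valid pS); first by exists F.
  by exists [::].
have /choice[h hP] pS : exists b, {in F pS, forall z, z < b}.
  have [|b bP] := @countable_ubound _ _ hT [set` F pS]; last by exists b.
  exact/finite_set_countable/finite_seq.
pose code (pS : X * {set 'I_n}) := ([seq co pS.1 k | k <- enum 'I_n], pS.2).
have codeI : injective code.
  move=> [p S] [q S'] [/eq_in_map pq ->]; congr (_, _); apply: co_inj => k.
  by apply: pq; rewrite mem_enum.
have /choice[e eP] r : exists e : nat -> X * {set 'I_n}, (forall i, valid (e i)) /\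
    forall x, same_block C r x -> exists i, box (F (e i)) (e i) x.
  have [b0 x0b] := range_ubound hT (co x0).
  have [b1 rb] := range_ubound hT (co r).
  (* The club point [w] above [r] bounds the nonstationary coordinates of the whole block of [r]. *)
  have [w _ [wb cw]] := stationaryT hT (Order.max a b1) g.
  have [dl [_ [wdl _] hdl]] :=
    stationary_club_closing hT statA h (Order.max w b0) id codeI.
  move: wdl wb; rewrite !gt_max => /andP[wdl b0dl] /andP[aw b1w].
  pose D := [set pS | valid pS /\ forall k, co pS.1 k < dl].
  have [||e [De eD]] := @countable_enum _ D.
  - apply: sub_countable (subset_card_le _) (countable_code hT dl codeI).
    by move=> pS [_ pdl] /= z /mapP[k _ ->]; exact/ltW.
  - exists (x0, finset.set0); split=> [k|k]; first by rewrite inE.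
    exact: lt_trans (x0b k) b0dl.
  exists e; split=> [i|x rx]; first by have [] := De i.
  (* Tails are used in the stationary factors where [x] reaches [dl]. There [p] borrows the
     coordinates of [x0], so all of [p] is below [dl] and [(p, S)] is enumerated. *)
  pose S := [set k | `[< stationary (A k) >] && (dl <= co x k)]%SET.
  pose p : X := repl x (fun k => if k \in S then co x0 k else co x k).
  have pE k : co p k = if k \in S then co x0 k else co x k.
    by apply: (co_repl x); case: ifP => _; exact: coP.
  have [|i ei] := eD (p, S).
    split=> [k|k]; first by rewrite inE => /andP[/asboolP].
    rewrite /= pE; case: ifPn => [_|]; first exact: lt_trans (x0b k) b0dl.
    rewrite inE negb_and -ltNge => /orP[/asboolP nk|//].
    apply: le_lt_trans wdl; rewrite -(rx k nk w (conj aw cw)).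
    exact/ltW/(lt_trans (rb k)).
  exists i => k z; rewrite ei /= => zF; case: ifPn => kS; last first.
    by rewrite pE (negbTE kS).
  have zdl : z < dl.
    apply: lt_trans (hP _ z zF) _; apply: hdl => u /mapP[j _ ->].
    by have [_] := De i; rewrite ei; exact.
  by move: kS; rewrite inE => /andP[_]; exact: lt_le_trans.
(* The choice depends only on the class of [x], hence is constant on blocks. *)
pose rep x : X := xget x0 (same_block C x).
have repP x : same_block C (rep x) x.
  apply: (sB); rewrite /rep; case: xgetP => // /(_ x)[].
  exact: open_equiv_refl (And3 oB sB tB).
apply: (countable_cover_separation (rep := rep)
  (O := fun r i => box (F (e r i)) (e r i))).
- move=> x; apply: filterS (oB x) => y xy; congr xget.
  apply/seteqP; split=> z; first exact: tB.
  by apply: (tB); exact: sB.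
- by move=> r i; exact: locally_constant_box.
- by move=> x; apply: (eP (rep x)).2.
- by move=> r i; apply: FP; exact: (eP r).1.
Qed.

End Normal.

(** * The plane in a product with a nonstationary intersection *)

Section NonstationaryIntersection.
Local Open Scope order_scope.
Local Open Scope classical_set_scope.
Context {d : Order.disp_t} {T : orderTopologicalType d} (hT : is_omega1 T).
Context {n : nat} {A : 'I_n -> set T}.
Local Notation X := (prod_topology (fun k : 'I_n => set_type (A k))).

Definition common (G : {set 'I_n}) : set T := [set x | forall k, k \in G -> A k x].

(** Take [G] maximal with stationary intersection. Some stationary [A i] lies outside [G], or the
    family would be good; maximality makes the larger intersection nonstationary, and [G] is
    nonempty because [A i] alone is stationary. *)
Lemma nonstationary_common : ~ stationary [set x | forall k, stationary (A k) -> A k x] ->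
  exists i j (G : {set 'I_n}), [/\ stationary (A i), stationary (common G),
    ~ stationary (A i `&` common G) & j \in G].
Proof.
move=> nE.
pose P (G : {set 'I_n}) := `[< stationary (common G) >].
have [|G /maxsetP[/asboolP statG maxG]] := @ex_maxset _ P.
  exists finset.set0; apply/asboolP; rewrite (_ : common _ = setT).
    exact: stationaryT.
  by apply/seteqP; split=> // x _ k; rewrite inE.
have [i [si iG]] : exists i, stationary (A i) /\ i \notin G.
  apply: contrapT => ni; apply: nE => a g; have [dl Gdl cdl] := statG a g.
  exists dl => // k sk; apply: Gdl; apply: contrapT => /negP kG.
  by apply: ni; exists k.
have nst : ~ stationary (A i `&` common G).
  move=> st; have := maxG (i |: G)%SET; rewrite subsetU1 => /(_ _ isT) E.
  move: iG; rewrite -E ?setU11//; apply/asboolP.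
  rewrite (_ : common _ = A i `&` common G)//; apply/seteqP; split=> x.
    by move=> Gx; split=> [|k kG]; apply: Gx; rewrite !inE ?eqxx// kG orbT.
  by move=> [Aix Gx] k; rewrite !inE => /orP[/eqP->//|]; exact: Gx.
have [E|[j jG]] := set_0Vmem G; last by exists i, j, G.
exfalso; apply: nst; rewrite (_ : _ `&` _ = A i)//.
by apply/seteqP; split=> x; [case|move=> Aix; split=> // k; rewrite E inE].
Qed.

Context (x0 : X) (i j : 'I_n) (G : {set 'I_n}).
Context (statA : stationary (A i)) (statB : stationary (common G)).
Context (nstat : ~ stationary (A i `&` common G)) (jG : j \in G).
Local Notation B := (common G).
Implicit Types u v : T.

Definition plane u v : X :=
  repl x0 (fun k => if k == i then u else if k \in G then v else co x0 k).

Lemma co_plane u v k : A i u -> B v ->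
  co (plane u v) k = if k == i then u else if k \in G then v else co x0 k.
Proof.
move=> Au Bv; apply: (co_repl x0); case: eqP => [->//|_].
by case: ifPn => [kG|_]; [exact: Bv|exact: coP].
Qed.

Lemma notin_common : i \notin G.
Proof.
apply/negP => iG; apply: nstat; rewrite (_ : _ `&` _ = B)//.
by apply/seteqP; split=> x; [case|move=> Bx; split=> //; exact: Bx].
Qed.

Lemma nonstationary_disjoint : exists a g, forall x, club a g x -> A i x -> B x -> False.
Proof.
have /existsNP[a /existsNP[g nag]] := nstat.
by exists a, g => x cx Ax Bx; apply: nag; exists x.
Qed.

Lemma co_plane_le u v dl k : A i u -> B v -> (forall k, co x0 k <= dl) ->
  u <= dl -> v <= dl -> co (plane u v) k <= dl.
Proof.
by move=> Au Bv x0dl udl vdl; rewrite co_plane//; case: ifP => // _; case: ifP.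
Qed.

Lemma same_plane F u u' v v' : A i u -> A i u' -> B v -> B v' ->
  {in F, forall z, (u <= z) = (u' <= z)} ->
  {in F, forall z, (v <= z) = (v' <= z)} ->
  same F (plane u v) (plane u' v').
Proof.
move=> Au Au' Bv Bv' uu vv k z zF; rewrite !co_plane//.
by case: ifP => [_|_]; [exact: uu|case: ifP => // _; exact: vv].
Qed.

(** * Corners of entourages and a winning strategy for Player II *)

Section Game.
Context (uX : Uniform.axioms_ X).
Local Notation UX := (Uniform.Pack uX : uniformType).
Context (nbhsX : forall x : X, @nbhs UX UX x = @nbhs X X x).

(** Pressing down on the second coordinate with [u] fixed: the cuts of a neighbourhood of
    [plane u v] lie below [v], so one list serves unboundedly many [v]. *)
Lemma plane_row (V : set (UX * UX)) u : entourage V -> A i u ->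
  exists F : seq T, forall c, exists v, [/\ B v, c < v &
    forall u' v', A i u' -> B v' -> u' <= u -> v' <= v ->
      {in F, forall z, (u <= z) = (u' <= z)} -> {in F, forall z, z < v'} ->
      V (plane u v, plane u' v')].
Proof.
move=> eV Au; have [c0 c0P] := range_ubound hT (co x0).
have /choice[f fP] v : exists F : seq T, B v -> Order.max u c0 < v ->
    {in F, forall z, z < v} /\
    forall x, same F (plane u v) x -> (forall k, co x k <= v) -> V (plane u v, x).
  have [[Bv]|nBv] := pselect (B v /\ Order.max u c0 < v); last first.
    by exists [::] => Bv uv; case: nBv.
  rewrite gt_max => /andP[uv c0v].
  have [||F [Fv FV]] := @nbhs_same _ _ _ A (plane u v) (xsection V (plane u v)) v.
  - rewrite -nbhsX -(@filter_from_entourageE UX); by exists V.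
  - move=> k; apply: co_plane_le => // [l|]; last exact: ltW.
    exact/ltW/(lt_trans (c0P l)).
  by exists F => _ _; split=> // x /FV xV /xV; rewrite /xsection /= inE.
have [||F FP] := @pressing_down _ _ hT _ unit (fun F => (F, tt)) f B
  (Order.max u c0) _ statB.
- by move=> F F' [].
- by move=> v Bv uv; case: (fP v Bv uv).
exists F => c; have [v [Bv]] := FP (Order.max c (Order.max u c0)).
rewrite gt_max => /andP[cv uv] fv; exists v; split=> // u' v' Au' Bv' u'u v'v uF Fv'.
have [Fv FV] := fP v Bv uv; rewrite fv in Fv FV.
move: (uv); rewrite gt_max => /andP[uv1 c0v].
apply: FV => [|k].
  by apply: same_plane => // z zF; rewrite leNgt Fv// leNgt Fv'.
apply: co_plane_le => // [l|]; first exact/ltW/(lt_trans (c0P l)).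
exact: le_trans u'u (ltW _).
Qed.

(** Pressing down on the first coordinate: rows [u'] beyond [u] share their cuts below [u'], and [c]
    bounds these. Both points are then close to the same [plane u' v]. *)
Lemma plane_initial_corner (U : set (UX * UX)) : entourage U ->
  exists c, forall u, A i u -> exists f, forall u1 u2 v1 v2,
    A i u1 -> A i u2 -> B v1 -> B v2 -> c < u1 -> c < u2 -> u1 <= u -> u2 <= u ->
    f < v1 -> f < v2 -> U (plane u1 v1, plane u2 v2).
Proof.
move=> /entourage_split_ex[W eW WU]; pose V := (W `&` W^-1)%relation.
have eV : entourage V by apply: filterI => //; exact: entourage_inv.
have /choice[F FP] u : exists F : seq T, A i u -> forall c, exists v, [/\ B v, c < v &
    forall u' v', A i u' -> B v' -> u' <= u -> v' <= v ->
      {in F, forall z, (u <= z) = (u' <= z)} -> {in F, forall z, z < v'} ->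
      V (plane u v, plane u' v')].
  have [Au|nAu] := pselect (A i u); last by exists [::].
  by have [F FP] := plane_row eV Au; exists F.
have [t _] := countable_ubound hT (countable0 T).
have [||L LP] := @pressing_down _ _ hT _ unit (fun F => (F, tt))
    (fun u => [seq z <- F u | z < u]) (A i) t _ statA.
- by move=> L L' [].
- by move=> u Au _ z; rewrite mem_filter => /andP[].
have [c cP] := countable_ubound hT (finite_set_countable (finite_seq L)).
exists c => u Au; have [u' [Au' uu' Fu']] := LP u.
have [f fP] := countable_ubound hT (finite_set_countable (finite_seq (F u'))).
exists f => u1 u2 v1 v2 Au1 Au2 Bv1 Bv2 cu1 cu2 u1u u2u fv1 fv2.
have [v [Bv + vP]] := FP u' Au' (Order.max v1 v2); rewrite gt_max => /andP[v1v v2v].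
have close w z : A i w -> c < w -> w <= u -> z \in F u' -> (u' <= z) = (w <= z).
  move=> Aw cw wu zF; have [u'z|zu'] := leP u' z.
    by rewrite (le_trans wu (le_trans (ltW uu') u'z)).
  apply/esym/negbTE; rewrite -ltNge; apply: lt_trans cw; apply: cP => /=.
  by rewrite -Fu' mem_filter zu'.
have near_u' w v1' : A i w -> B v1' -> c < w -> w <= u -> f < v1' -> v1' <= v ->
    V (plane u' v, plane w v1').
  move=> Aw Bv1' cw wu fv1' v1'v; apply: vP => //.
  - exact: le_trans wu (ltW uu').
  - by move=> z zF; exact: close.
  - by move=> z zF; exact: lt_trans (fP z zF) fv1'.
apply: WU; exists (plane u' v).
  by case: (near_u' u1 v1 Au1 Bv1 cu1 u1u fv1 (ltW v1v)).
by case: (near_u' u2 v2 Au2 Bv2 cu2 u2u fv2 (ltW v2v)).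
Qed.

(** The bound [u] on the first coordinates disappears by passing through a point with the smaller
    first coordinate and a second coordinate high enough for both. *)
Lemma plane_corner (U : set (UX * UX)) : entourage U ->
  exists cf : T * (T -> T), forall u1 u2 v1 v2,
    A i u1 -> A i u2 -> B v1 -> B v2 -> cf.1 < u1 -> cf.1 < u2 ->
    cf.2 u1 < v1 -> cf.2 u2 < v2 -> U (plane u1 v1, plane u2 v2).
Proof.
move=> /entourage_split_ex[W eW WU].
have [c cP] := plane_initial_corner eW.
have /choice[f fP] u : exists f, A i u -> forall u1 u2 v1 v2,
    A i u1 -> A i u2 -> B v1 -> B v2 -> c < u1 -> c < u2 -> u1 <= u -> u2 <= u ->
    f < v1 -> f < v2 -> W (plane u1 v1, plane u2 v2).
  have [Au|nAu] := pselect (A i u); last by exists c.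
  by have [f fP] := cP u Au; exists f.
exists (c, f) => u1 u2 v1 v2 Au1 Au2 Bv1 Bv2 /= cu1 cu2 fv1 fv2; apply: WU.
have [v Bv] := stationary_unbounded (Order.max (f u1) (f u2)) statB.
rewrite gt_max => /andP[f1v f2v].
have [u12|u21] := leP u1 u2.
  exists (plane u1 v); first by apply: (fP u1).
  by apply: (fP u2).
exists (plane u2 v); last by apply: (fP u2).
by apply: (fP u1) => //; exact: ltW.
Qed.

(* Player II stays in the corner of every entourage played so far. Consecutive
   coordinates are interleaved with points of a club missing [A i `&` B], so the only
   possible limit is not a point of [X]. *)
Lemma winningII_plane : exists s : strategyII UX, winningII s.
Proof.
have [a [g CAB]] := nonstationary_disjoint.
have /choice[cf cfP] U : exists cf : T * (T -> T), @entourage UX U ->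
    forall u1 u2 v1 v2, A i u1 -> A i u2 -> B v1 -> B v2 -> cf.1 < u1 -> cf.1 < u2 ->
    cf.2 u1 < v1 -> cf.2 u2 < v2 -> U (plane u1 v1, plane u2 v2).
  have [eU|nU] := pselect (@entourage UX U); last by exists (a, id).
  by have [cf cfP] := plane_corner eU; exists cf.
have /choice[nA nAP] t : exists u, A i u /\ t < u.
  by have [u] := stationary_unbounded t statA; exists u.
have /choice[nB nBP] t : exists v, B v /\ t < v.
  by have [v] := stationary_unbounded t statB; exists v.
have /choice[nC nCP] t : exists c, club a g c /\ t < c.
  have [c _ [+ cc]] := stationaryT hT (Order.max a t) g.
  by rewrite gt_max => /andP[ac tc]; exists c.
(* The state holds a corner [(c, f)] inside all corners so far and the last point. The new point
   lies in that corner, with [u] above the previous [v] and a club point between [u] and [v]. *)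
pose step (st : (T * (T -> T)) * (T * T)) U :=
  let c := Order.max st.1.1 (cf U).1 in
  let f := fun w => Order.max (st.1.2 w) ((cf U).2 w) in
  let u := nA (Order.max c st.2.2) in
  let v := nB (Order.max (f u) (nC u)) in ((c, f), (u, v)).
pose state := foldl step ((a, fun=> a), (a, a)).
exists (fun l => plane (state l).2.1 (state l).2.2).
move=> U legU.
pose st m := state (mkseq U m).
have stS m : st m.+1 = step (st m) (U m).
  by rewrite /st /state mkseqS -cats1 foldl_cat.
pose u m := (st m.+1).2.1; pose v m := (st m.+1).2.2.
have Au m : A i (u m) by rewrite /u stS; exact: (nAP _).1.
have Bv m : B (v m) by rewrite /v stS; exact: (nBP _).1.
have bound m k : (k < m)%N ->
    (cf (U k)).1 <= (st m).1.1 /\ forall w, (cf (U k)).2 w <= (st m).1.2 w.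
  elim: m => // m IH; rewrite ltnS leq_eqVlt stS /= => /orP[/eqP->|/IH[bc bf]].
    by split=> [|w]; rewrite le_max lexx orbT.
  by split=> [|w]; rewrite le_max ?bc ?bf.
have cu m : (st m.+1).1.1 < u m.
  rewrite /u stS /=; apply: le_lt_trans (nAP _).2.
  by rewrite le_max lexx.
have fv m : (st m.+1).1.2 (u m) < v m.
  by rewrite /u /v stS /=; apply: le_lt_trans (nBP _).2; rewrite le_max lexx.
have ucv m : nC (u m) < v m.
  by rewrite /u /v stS /=; apply: le_lt_trans (nBP _).2; rewrite le_max lexx orbT.
have vu m : v m < u m.+1.
  rewrite /u stS /=; apply: le_lt_trans (nAP _).2.
  by rewrite le_max lexx orbT.
have ck m k : (k <= m)%N -> (cf (U k)).1 < u m.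
  by rewrite -ltnS => /bound[/le_lt_trans + _]; apply.
have fk m k : (k <= m)%N -> (cf (U k)).2 (u m) < v m.
  by rewrite -ltnS => /bound[_ /(_ (u m))/le_lt_trans]; apply.
have uv m : u m < v m by apply: lt_trans (nCP _).2 (ucv m).
have replyE m : replyII (fun l => plane (state l).2.1 (state l).2.2) U m =
  plane (u m) (v m) by [].
split=> [m|[/seteqP[V0 _]|[l xl]]].
- rewrite /xsection /= inE !replyE; apply: cfP => //; first exact: (legU m).1.
  + exact: ck.
  + exact: ck.
  + exact: fk.
  + exact: fk.
(* Bounding the countably many corners at once gives a point lying in every section. *)
- have [c cP] := range_ubound hT (fun m => (cf (U m)).1).
  have [Au' cu'] := nAP c.
  have [f fP] := range_ubound hT (fun m => (cf (U m)).2 (nA c)).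
  have [Bv' fv'] := nBP f.
  apply: (V0 (plane (nA c) (nB f))) => m _.
  rewrite /xsection /= inE replyE; apply: cfP => //; first exact: (legU m).1.
  + exact: ck.
  + exact: lt_trans cu'.
  + exact: fk.
  + exact: lt_trans fv'.
have ev k (W : set T) : nbhs (co l k) W ->
    exists N, forall m, (N <= m)%N -> W (co (plane (u m) (v m)) k).
  move=> lW; have [|N _ NP] := xl (co^~ k @^-1` W); last by exists N.
  by rewrite nbhsX; exact: (co_continuous lW).
have ev_le k w : co l k <= w ->
    exists N, forall m, (N <= m)%N -> co (plane (u m) (v m)) k <= w.
  move=> lw; apply: (ev k [set y | y <= w]).
  exact: open_nbhs_nbhs (conj (open_le hT w) lw).
have ev_gt k w : w < co l k ->
    exists N, forall m, (N <= m)%N -> w < co (plane (u m) (v m)) k.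
  move=> lw; apply: (ev k [set y | w < y]).
  exact: open_nbhs_nbhs (conj (open_gt w) lw).
have coi m : co (plane (u m) (v m)) i = u m by rewrite co_plane// eqxx.
have coG k m : k \in G -> co (plane (u m) (v m)) k = v m.
  move=> kG; rewrite co_plane//; case: eqP => [ki|_]; last by rewrite kG.
  by move: kG; rewrite ki (negbTE notin_common).
(* Since [u m < v m < u m.+1], the coordinates interleave and their limits agree. *)
have liG k : k \in G -> co l k = co l i.
  move=> kG; have [kl|ik|//] := ltgtP (co l k) (co l i).
    have [N NP] := ev_gt _ _ kl; have [M MP] := ev_le k _ (lexx _).
    pose m := maxn N M.
    have := MP m (leq_maxr N M); have := NP m (leq_maxl N M).
    rewrite coi coG// => /lt_trans/(_ (uv m))/lt_le_trans + vk => /(_ _ vk).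
    by rewrite ltxx.
  have [N NP] := ev_gt _ _ ik; have [M MP] := ev_le i _ (lexx _).
  have := NP (maxn N M) (leq_maxl N M).
  have := MP (maxn N M).+1 (leq_trans (leq_maxr N M) (leqnSn _)).
  rewrite coi coG// => /(lt_le_trans (vu _)) vl lv.
  by have := lt_trans lv vl; rewrite ltxx.
have [N0 N0P] := ev_le j _ (lexx _).
have Bl : B (co l i) by move=> k kG; rewrite -(liG k kG); exact: coP.
(* The common limit is a limit of the club points [nC (u m)], hence itself in the club. *)
apply: (CAB (co l i)); [split|exact: coP|exact: Bl].
- have := N0P N0 (leqnn _); rewrite coG// liG//; apply: lt_le_trans.
  by apply: lt_trans (ucv N0); case: (nCP (u N0)) => -[].
- move=> x xl'; have [M MP] := ev_gt i x xl'.
  have := MP (maxn N0 M) (leq_maxr N0 M); have := N0P (maxn N0 M) (leq_maxl N0 M).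
  rewrite coi coG// liG// => vl xu; have [[_ cC] uC] := nCP (u (maxn N0 M)).
  exact: lt_trans (cC x (lt_trans xu uC)) (lt_le_trans (ucv _) vl).
Qed.

End Game.

(** * Failure of normality on the plane *)

Lemma closed_le_fun (Y : topologicalType) (f h : Y -> T) :
  continuous f -> continuous h -> closed [set y | f y <= h y].
Proof.
move=> fc hc; rewrite -openC openE => y /negP; rewrite -ltNge => hf.
have near_h : \forall z \near y, h z <= h y.
  exact: (hc y _ (open_nbhs_nbhs (conj (open_le hT (h y)) (lexx _)))).
have near_f : \forall z \near y, h y < f z.
  exact: (fc y _ (open_nbhs_nbhs (conj (open_gt (h y)) hf))).
apply: filterS2 near_h near_f => z hz fz /=.
by apply/negP; rewrite -ltNge; exact: le_lt_trans fz.
Qed.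

Lemma closed_club (a : T) g : closed (club a g).
Proof.
rewrite -openC openE => x nCx.
have near_le : \forall y \near x, y <= x.
  exact: (open_nbhs_nbhs (conj (open_le hT x) (lexx x))).
apply: filterS2 (near_unseparated hT nCx) near_le => y uxy yx Cy; apply: nCx.
have xy : x <= y by rewrite (uxy y Cy).
by rewrite (_ : x = y)//; apply/le_anti; rewrite xy yx.
Qed.

Lemma plane_closed : closed [set x : X | forall k, k != i ->
  co x k = if k \in G then co x j else co x0 k].
Proof.
rewrite (_ : [set x | _] = \bigcap_(k in [set k | k != i])
    [set x : X | co x k <= if k \in G then co x j else co x0 k] `&`
  \bigcap_(k in [set k | k != i])
    [set x : X | (if k \in G then co x j else co x0 k) <= co x k]).
  have ifc k : continuous (fun x : X => if k \in G then co x j else co x0 k).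
    by case: (k \in G); [exact: co_continuous|exact: cst_continuous].
  apply: closedI; apply: closed_bigI => k _; apply: closed_le_fun => //;
    exact: co_continuous.
apply/seteqP; split=> x.
  by move=> xP; split=> k ki /=; rewrite (xP k ki).
by move=> [le1 le2] k ki; apply/le_anti/andP; split; [exact: le1|exact: le2].
Qed.

Lemma not_normal_plane : ~ normal_space X.
Proof.
move=> nX.
have [a [g CAB]] := nonstationary_disjoint.
have /choice[beta betaP] t : exists v, B v /\ t < v.
  by have [v] := stationary_unbounded t statB; exists v.
have [a1 [g1 sub1]] := clubI hT (fun b : bool => a) (fun b => if b then g else beta).
pose C := club a1 g1.
have C_AB x : C x -> A i x -> ~ B x.
  by move=> Cx Ax Bx; apply: (CAB x) => //; exact: (sub1 true).
have C_beta x y : C x -> y < x -> beta y < x.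
  by move=> /(sub1 false)[_]; exact.
have /choice[nC nCP] t : exists c, C c /\ t < c.
  have [c _ [+ cc]] := stationaryT hT (Order.max a1 t) g1.
  by rewrite gt_max => /andP[ac tc]; exists c.
have [a2 [g2 sub2]] := clubI hT (fun b : bool => a1) (fun b => if b then g1 else nC).
pose C' := club a2 g2.
pose Y : set X := [set x : X | forall k, k != i ->
  co x k = if k \in G then co x j else co x0 k].
(* In [K] the first coordinate is some [c] in [C], and the second runs from [c] to at most the next
   point of [C]. *)
pose K := Y `&` [set x | C (co x i)] `&` [set x | co x i <= co x j] `&`
  \bigcap_(c in C) ([set x | c <= co x i] `|` [set x | co x j <= c]).
pose H := Y `&` [set x | C' (co x j)] `&` [set x | co x i <= co x j].
have ij : j != i by apply: contraTneq jG => ->; exact: notin_common.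
have cle : closed [set x : X | co x i <= co x j].
  by apply: closed_le_fun; exact: co_continuous.
have ccl k a' g' : closed [set x : X | club a' g' (co x k)].
  apply: (@closed_comp _ _ (fun x : X => co x k)); last exact: closed_club.
  by move=> x _; exact: co_continuous.
have cstc c : continuous (fun _ : X => c : T) by exact: cst_continuous.
have cK : closed K.
  apply: closedI.
    apply: closedI; last exact: cle.
    by apply: closedI; [exact: plane_closed|exact: ccl].
  apply: closed_bigI => c _; apply: closedU; apply: closed_le_fun;
    by [exact: cstc|exact: co_continuous].
have cH : closed H.
  apply: closedI; last exact: cle.
  by apply: closedI; [exact: plane_closed|exact: ccl].
have KH : K `&` H = set0.
  (* Equal coordinates would give a point of [C] in both [A i] and [B]. Otherwise, [C'] being closed
     under [nC], a point of [C] lies strictly between them. *)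
  apply/seteqP; split=> // x [[[[Yx Cxi] _] sep] [[_ C'x]]] /=.
  rewrite le_eqVlt => /orP[/eqP E|ltij].
    apply: (C_AB _ Cxi); first exact: coP.
    move=> k kG; rewrite E; have := coP x k; rewrite Yx ?kG//.
    by apply: contraTneq kG => ->; exact: notin_common.
  have [_ /(_ _ ltij) nij] := sub2 false _ C'x.
  have [Cn xn] := nCP (co x i).
  by have [] := sep _ Cn => /=; rewrite leNgt ?xn ?nij.
have [V [KV VH]] := normal_separation nX cK cH KH.
have planeY u v : A i u -> B v -> Y (plane u v).
  by move=> Au Bv k ki; rewrite !co_plane// (negbTE ki) (negbTE ij) jG.
have Kplane c : A i c -> C c -> K (plane c (beta c)).
  move=> Ac Cc; have [Bc cb] := betaP c.
  have cE : co (plane c (beta c)) i = c by rewrite co_plane// eqxx.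
  have bE : co (plane c (beta c)) j = beta c by rewrite co_plane// (negbTE ij) jG.
  split; [split; [split|]|] => //=; rewrite ?cE ?bE.
  - exact: planeY.
  - by [].
  - exact: ltW.
  - move=> c' Cc' /=; rewrite cE bE; have [|cc'] := leP c' c; [by left|right].
    exact/ltW/C_beta.
have [c0 c0P] := range_ubound hT (co x0).
have /choice[F FP] c : exists F : seq T, A i c -> C c -> c0 < c -> forall x : X,
    same F (plane c (beta c)) x -> (forall k, co x k <= beta c) -> V x.
  have [[Ac [Cc c0c]]|nc] := pselect (A i c /\ C c /\ c0 < c); last first.
    by exists [::] => Ac Cc c0c; case: nc.
  have [Bc cb] := betaP c.
  have [|F [_ FV]] := nbhs_same (KV _ (Kplane c Ac Cc)) (dl := beta c).
    move=> k; apply: co_plane_le => //; last exact: ltW.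
    by move=> l; exact/ltW/(lt_trans (c0P l))/(lt_trans c0c).
  by exists F => _ _ _.
(* The cuts below [c] are the same for unboundedly many [c]. A point [u] above them is not separated
   from any such [c > u], so [V] contains [plane u (beta c)]. *)
have [||L LP] := @pressing_down _ _ hT _ unit (fun F => (F, tt))
    (fun c => [seq z <- F c | z < c]) (A i `&` C) c0 _ (stationary_club hT _ _ statA).
- by move=> ? ? [].
- by move=> c _ _ z; rewrite mem_filter => /andP[].
have [eta etaP] := countable_ubound hT (finite_set_countable (finite_seq L)).
have [u Au etau] := stationary_unbounded eta statA.
have /choice[zeta zetaP] x : exists v, [/\ B v, x < v & V (plane u v)].
  have [c [[Ac Cc]]] := LP (Order.max c0 (Order.max u x)).
  rewrite !gt_max => /and3P[c0c uc xc] Lc; have [Bc cb] := betaP c.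
  exists (beta c); split=> //; first exact: lt_trans cb.
  apply: (FP c) => //; last first.
    move=> k; apply: co_plane_le => //; last exact/ltW/(lt_trans uc).
    by move=> l; exact/ltW/(lt_trans (c0P l))/(lt_trans c0c).
  apply: same_plane => // z zF; have [cz|zc] := leP c z.
    by rewrite (le_trans (ltW uc) cz).
  apply/esym/negbTE; rewrite -ltNge; apply: lt_trans etau; apply: etaP => /=.
  by rewrite -Lc mem_filter zc.
(* A [dl] in [B] and [C'] that is closed under [zeta] makes [plane u dl] a point of [H] and a limit
   of the points [plane u (zeta x)] of [V]. *)
have [a3 [g3 sub3]] := clubI hT (fun b : bool => if b then a2 else Order.max u c0)
                                (fun b => if b then g2 else zeta).
have [dl Bdl cdl] := statB a3 g3.
have C'dl := sub3 true _ cdl; have [+ zdl] := sub3 false _ cdl.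
rewrite gt_max => /andP[udl c0dl].
suff : (closure V `&` H) (plane u dl) by rewrite VH.
split; last first.
  split; [split|] => /=; first exact: planeY.
    by rewrite co_plane// (negbTE ij) jG.
  by rewrite !co_plane// eqxx (negbTE ij) jG ltW.
move=> W /nbhs_same pW.
have [k|F' [F'dl F'W]] := pW dl.
  apply: co_plane_le => // [l|]; last exact: ltW.
  exact/ltW/(lt_trans (c0P l)).
have [x [_ xdl xF]] := seq_ubound udl F'dl.
have [Bz xz Vz] := zetaP x; exists (plane u (zeta x)); split=> //.
apply: F'W => [|k].
  apply: same_plane => // z zF; rewrite [dl <= z]leNgt F'dl//=.
  by apply/esym/negbTE; rewrite -ltNge; exact: le_lt_trans (xF z zF) xz.
apply: co_plane_le => //; [move=> l|exact: ltW|exact/ltW/zdl].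
exact/ltW/(lt_trans (c0P l)).
Qed.

End NonstationaryIntersection.

(** * The equivalence, by cases on whether the family is good *)

Theorem theorem4 (d : Order.disp_t) (T : orderTopologicalType d)
    (hT : is_omega1 T) (n : nat) (A : 'I_n -> set T) :
  semi_proximal (prod_topology (fun k : 'I_n => set_type (A k))) <->
  normal_space (prod_topology (fun k : 'I_n => set_type (A k))).
Proof.
set X := prod_topology _.
have [good|bad] :=
    pselect (stationary [set x | forall k, stationary (A k) -> A k x]%classic).
  by split=> _; [exact: normal_prod|exact: semi_proximal_prod].
(* The plane needs a base point. An empty product is normal, and semi-proximal because no strategy
   exists. *)
have [[x0 _]|nX] := pselect (exists x : X, True); last first.
  split=> _.
    apply: normal_spaceP => H K _ _ _; exists set0.
    by split=> [x|x|]; [case: nX; exists x..|rewrite set0I].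
  exists (Uniform.class (partition_space X : uniformType)).
  split=> [|[s _]]; first exact: nbhs_partition_space (same_base hT).
  by apply: nX; exists (s [::]).
have [i [j [G [statA statB nstat jG]]]] := nonstationary_common hT bad.
split=> [[uX [nbhsX]]|].
  by case; exact: (winningII_plane hT x0 statA statB nstat jG nbhsX).
by move=> /(not_normal_plane hT x0 statA statB nstat jG).
Qed.
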